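(* Let $I=(-a,a)$ with $a>0$, or $I=\mathbb{R}$ (the case $a=\infty$). Let $\mathcal{C}$ be the family of all subsets $S\subseteq I\setminus\{0\}$ such that, for each $x\in I$ with $x\neq0$, exactly one of $x\in S$ and $-x\in S$ holds. Then for every $S\in\mathcal{C}$ and every function $y^0:S\to\mathbb{R}$ there is a unique function $y:I\to\mathbb{R}$ such that $y(-x)=-y(x)$ for all $x\in I$ and $y(x)=y^0(x)$ for all $x\in S$.
   Context: No continuity is assumed. *)

(* Defs.v *)
From mathcomp Require Import all_boot all_order all_algebra.
From mathcomp Require Import boolp classical_sets reals constructive_ereal.
From mathcomp Require Import set_interval.

Set Implicit Arguments.
Unset Strict Implicit.
Unset Printing Implicit Defensive.

Import Order.TTheory GRing.Theory Num.Theory.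

Local Open Scope classical_set_scope.
Local Open Scope ring_scope.

(* The endpoint [a] is extended real, so that the case [a = +oo] is the whole
   real line; see [sym_itv_fin] and [sym_itv_pinfty]. *)
Definition sym_itv (R : realType) (a : \bar R) : set R :=
  [set x | (- a < x%:E < a)%E].

Lemma sym_itv_fin (R : realType) (r : R) :
  sym_itv r%:E = [set` `](- r), r[%R].
Proof. by apply/seteqP; split => x; rewrite /sym_itv /= in_itv /= !lte_fin. Qed.

Lemma sym_itv_pinfty (R : realType) : sym_itv (+oo%E : \bar R) = setT.
Proof.
by apply/seteqP; split => x //= _; rewrite /sym_itv /= ltNyr ltry.
Qed.

Lemma sym_itvN (R : realType) (a : \bar R) (x : R) :
  x \in sym_itv a -> - x \in sym_itv a.
Proof.
rewrite !inE /sym_itv /= EFinN => /andP[ax xa].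
by apply/andP; split; rewrite ?lteN2 // -[ltRHS]oppeK lteN2.
Qed.

(* In the following, the interval is coerced to the type of its elements, so
   functions on it (and on its subsets) are compared by Leibniz equality. *)
Definition itv_opp (R : realType) (a : \bar R) (x : sym_itv a) : sym_itv a :=
  exist _ (- \val x) (sym_itvN (valP x)).

Definition half_sets (R : realType) (a : \bar R) : set (set (sym_itv a)) :=
  [set S | S `<=` [set x | \val x != 0] /\
    forall x : sym_itv a, \val x != 0 ->
      (S x /\ ~ S (itv_opp x)) \/ (~ S x /\ S (itv_opp x))].

Arguments half_sets {R} a _.

(* Main.v *)
(* The solution is y(x) = e(x) - e(-x), where e extends y0 by zero outside S:
   it is odd by construction, and on S the second term vanishes. *)
Require Import Defs.
From mathcomp Require Import all_boot all_order all_algebra.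
From mathcomp Require Import boolp classical_sets reals constructive_ereal.
From mathcomp Require Import set_interval.

Import Order.TTheory GRing.Theory Num.Theory.

Local Open Scope classical_set_scope.
Local Open Scope ring_scope.

(** An odd function vanishes at 0, and any other point lies in [S] or has its opposite there, so the
    values on [S] determine it ([odd_eq_on_half]). Conversely, antisymmetrising the extension of
    [y0] by zero does not disturb the values on [S], because [S] never contains both a point and its
    opposite ([half_sets_oppN]). *)

Lemma itv_oppK (R : realType) (a : \bar R) : involutive (@itv_opp R a).
Proof. by move=> x; apply: val_inj; rewrite /= opprK. Qed.

Lemma itv_opp_fixed (R : realType) (a : \bar R) (x : sym_itv a) :
  \val x = 0 -> itv_opp x = x.
Proof. by move=> x0; apply: val_inj; rewrite /= x0 oppr0. Qed.

Lemma half_sets_oppN (R : realType) (a : \bar R) (S : set (sym_itv a))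
    (x : sym_itv a) : half_sets a S -> S x -> ~ S (itv_opp x).
Proof. by move=> [S0 SN] Sx; case: (SN x (S0 x Sx)) => -[]. Qed.

Lemma odd_eq_on_half (R : realType) (a : \bar R) (S : set (sym_itv a))
    (y z : sym_itv a -> R) : half_sets a S ->
  (forall x, y (itv_opp x) = - y x) -> (forall x, z (itv_opp x) = - z x) ->
  {in S, y =1 z} -> y = z.
Proof.
move=> [_ SN] yN zN yz; apply/funext => x.
have [x0|x0] := eqVneq (\val x) 0.
  have odd0 (f : sym_itv a -> R) : f (itv_opp x) = - f x -> f x = 0.
    (* At the fixed point of [itv_opp], oddness reads [f x = - f x], so twice [f x] is 0. *)
    by rewrite itv_opp_fixed // => /eqP; rewrite -addr_eq0 -mulr2n mulrn_eq0 => /eqP.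
  by rewrite (odd0 y (yN x)) (odd0 z (zN x)).
case: (SN x x0) => -[Sx SNx]; first by apply: yz; rewrite inE.
(* Here the opposite of [x] is in [S]: compare [y] and [z] there and transfer by oddness. *)
by apply: oppr_inj; rewrite -yN -zN; apply: yz; rewrite inE.
Qed.

Theorem theorem4p2 (R : realType) (a : \bar R) (ha : (0 < a)%E)
    (S : set (sym_itv a)) (hS : half_sets a S) (y0 : S -> R) :
  exists! y : sym_itv a -> R,
    (forall x : sym_itv a, y (itv_opp x) = - y x) /\
    (forall x : S, y (\val x) = y0 x).
Proof.
pose e (x : sym_itv a) : R := oapp y0 0 (insub x : option S).
exists (fun x => e x - e (itv_opp x)); split; first split => x.
- by rewrite itv_oppK opprB.
(* The opposite of a point of [S] is outside [S], so [insub] gives [None] and [e] takes its default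
   0. *)
- rewrite /e valK insubN ?subr0 //.
  by apply/negP; rewrite inE; apply: half_sets_oppN => //; exact: set_mem (valP x).
move=> z [zN zS]; apply: (odd_eq_on_half _ _ _ _ _ hS) => // [x|x xS].
  by rewrite itv_oppK opprB.
rewrite /e insubT insubN ?subr0 /= -?zS //.
by apply/negP; rewrite inE; apply: half_sets_oppN => //; exact: set_mem xS.
Qed.
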